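(* Let $I$ be an index set, $\epsilon_{ij}=\epsilon_{ji}\in\{0,1\}$ for $i,j\in I$, and let $d:[n]\to I$ be a decoration. Let $\mathcal P_n^d$ be the lattice of $d$-decorated partitions of $[n]$ ordered by refinement, and let $\mathcal P_n^{d,\epsilon}\subset\mathcal P_n^d$ be the subset of $\epsilon$-noncrossing partitions, with the induced partial order. Then the meet in $\mathcal P_n^d$ is also the meet in $\mathcal P_n^{d,\epsilon}$ (in particular, the meet in $\mathcal P_n^d$ of two elements of $\mathcal P_n^{d,\epsilon}$ lies in $\mathcal P_n^{d,\epsilon}$). Moreover, $\mathcal P_n^{d,\epsilon}$ is a lattice.
   Context: $[n]=\{1,\dots,n\}$. The diagonal values $\epsilon_{ii}$ are arbitrary in $\{0,1\}$. Decorated partitions. A decoration is a map $d:[n]\to I$. A $d$-decorated partition of $[n]$ is a set partition $\Gamma=\Gamma_1\coprod\cdots\coprod\Gamma_k$ of $[n]$ (blocks non-empty), each $j\in[n]$ carrying the decoration $d(j)$; $\mathcal P_n^d$ is the set of these. The order is $\Gamma\le\Theta$ if $\Gamma$ is finer than $\Theta$; the meet $\Gamma\wedge\Gamma'$ in $\mathcal P_n^d$ has as blocks the non-empty intersections of blocks of $\Gamma$ with blocks of $\Gamma'$. For $\sigma\in S_n$, $\sigma(\Gamma)$ is the partition with blocks $\sigma(\Gamma_i)$, decorated by $\sigma(d):=d\circ\sigma^{-1}$. For a decorated partition of a finite set $X=\{x_1<\dots<x_n\}$ of integers with decoration $d:X\to I$, its standardization $st$ is the decorated partition of $[n]$ obtained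 by relabelling $x_j\mapsto j$, with decoration $st(d)(j)=d(x_j)$. Allowed moves. For $\Gamma\in\mathcal P_n^d$, the transposition $\tau_i=(i,i+1)$ is an allowed move, from $\Gamma$ to the $\tau_i(d)$-decorated partition $\tau_i(\Gamma)$, if $\epsilon_{d(i)d(i+1)}=1$ and either $d(i)\ne d(i+1)$, or $d(i)=d(i+1)$ and $i,i+1$ belong to different blocks of $\Gamma$. A permutation $\sigma=\tau_{i_k}\cdots\tau_{i_1}$ (possibly the empty product) is an allowed permutation of $\Gamma$ if each $\tau_{i_j}$ is an allowed move from $\tau_{i_{j-1}}\cdots\tau_{i_1}(\Gamma)$ to $\tau_{i_j}\cdots\tau_{i_1}(\Gamma)$. $\epsilon$-noncrossing partitions. A reduction of $\Gamma$ is a pair $(\sigma,i)$ with $\sigma$ an allowed permutation of $\Gamma$ and $i$ such that $\sigma(\Gamma_i)$ is an interval (set of consecutive integers) in $[n]$; it reduces $\Gamma$ to the standardization of the decorated partition obtained from $\sigma(\Gamma)$ by deleting the block $\sigma(\Gamma_i)$. $\Gamma$ is $\epsilon$-noncrossing if it can be reduced to the empty partition by a sequence of reductions. *)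

(* Defs.v *)
From HB Require Import structures.
From mathcomp Require Import all_boot all_order all_fingroup.

Set Implicit Arguments.
Unset Strict Implicit.
Unset Printing Implicit Defensive.

Import Order.Theory.

(** The set [n] = {1, ..., n} is rendered by 'I_n = {0, ..., n - 1}, and the
    0/1-matrix epsilon by a boolean function on I x I. *)

(** ** The lattice of [d]-decorated partitions *)

(* [d] is a phantom parameter: all elements of the lattice carry the same
   decoration, so only the underlying set partition is stored. *)
Record dpartition (I : Type) (n : nat) (d : 'I_n -> I) := DPartition {
  blocks :> {set {set 'I_n}};
  _ : partition blocks [set: 'I_n]
}.

HB.instance Definition _ I n (d : 'I_n -> I) := [isSub for @blocks I n d].
HB.instance Definition _ I n (d : 'I_n -> I) :=
  [Finite of dpartition d by <:].

Definition finer n (G H : {set {set 'I_n}}) : bool :=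
  [forall B in G, exists C in H, B \subset C].

Lemma finerP n (G H : {set {set 'I_n}}) :
  reflect (forall B, B \in G -> exists2 C, C \in H & B \subset C) (finer G H).
Proof.
apply: (iffP forall_inP) => GH B /GH; first by move=> /exists_inP.
by move=> ex; apply/exists_inP.
Qed.

Definition refines I n (d : 'I_n -> I) (G H : dpartition d) : bool := finer G H.

Lemma dpartition_partition I n (d : 'I_n -> I) (G : dpartition d) :
  partition G [set: 'I_n].
Proof. exact: valP G. Qed.

Lemma refines_refl I n (d : 'I_n -> I) : reflexive (@refines I n d).
Proof. by move=> G; apply/finerP => B BG; exists B. Qed.

Lemma refines_trans I n (d : 'I_n -> I) : transitive (@refines I n d).
Proof.
move=> H G K /finerP GH /finerP HK; apply/finerP => B /GH[C /HK[D DK CD] BC].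
by exists D => //; apply: subset_trans CD.
Qed.

Lemma finer_sub I n (d : 'I_n -> I) (G H : dpartition d) :
  refines G H -> refines H G -> G \subset H.
Proof.
move=> /finerP GH /finerP HG; apply/subsetP => B BG.
have [C CH BC] := GH B BG; have [D DG CD] := HG C CH.
have /and3P[_ /trivIsetP tG n0G] := dpartition_partition G.
have eBD : B = D.
  apply: contraNeq n0G => /(tG _ _ BG DG); rewrite -setI_eq0.
  by rewrite (setIidPl (subset_trans BC CD)) => /eqP <-.
by have -> : B = C by apply/eqP; rewrite eqEsubset BC eBD CD.
Qed.

Lemma refines_anti I n (d : 'I_n -> I) : antisymmetric (@refines I n d).
Proof.
move=> G H /andP[GH HG]; apply: val_inj; apply/eqP.
by rewrite eqEsubset !finer_sub.
Qed.

Fact refinement_display : Order.disp_t. Proof. exact: Order.Disp tt tt. Qed.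

HB.instance Definition _ I n (d : 'I_n -> I) :=
  Order.Le_isPOrder.Build refinement_display (dpartition d)
    (@refines_refl I n d) (@refines_anti I n d) (@refines_trans I n d).

Definition meet_blocks n (G H : {set {set 'I_n}}) : {set {set 'I_n}} :=
  [set B :&: C | B in G, C in H] :\ set0.

Lemma meet_blocks_partition n (G H : {set {set 'I_n}}) :
  partition G [set: 'I_n] -> partition H [set: 'I_n] ->
  partition (meet_blocks G H) [set: 'I_n].
Proof.
move=> /and3P[/eqP cG /trivIsetP tG _] /and3P[/eqP cH /trivIsetP tH _].
apply/and3P; split; last by rewrite !inE eqxx.
  apply/eqP/setP => x; rewrite inE; apply/bigcupP.
  have /bigcupP[B BG xB] : x \in cover G by rewrite cG.
  have /bigcupP[C CH xC] : x \in cover H by rewrite cH.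
  exists (B :&: C); last by rewrite inE xB.
  rewrite in_setD1 imset2_f // andbT; apply/set0Pn; exists x.
  by rewrite inE xB.
apply/trivIsetP => X Y /setD1P[_ /imset2P[B C BG CH ->]].
move=> /setD1P[_ /imset2P[B' C' BG' CH' ->]] neq.
rewrite -setI_eq0 setIACA setI_eq0.
case: (eqVneq B B') neq => [<-|nB _]; last first.
  by move: (tG _ _ BG BG' nB); rewrite -!setI_eq0 => /eqP ->; rewrite set0I.
case: (eqVneq C C') => [<-|nC _]; first by rewrite eqxx.
by move: (tH _ _ CH CH' nC); rewrite -!setI_eq0 => /eqP ->; rewrite setI0.
Qed.

Definition dmeet I n (d : 'I_n -> I) (G H : dpartition d) : dpartition d :=
  DPartition d (meet_blocks_partition (dpartition_partition G)
                                      (dpartition_partition H)).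

Lemma refines_dmeet I n (d : 'I_n -> I) (K G H : dpartition d) :
  (K <= dmeet G H)%O = (K <= G)%O && (K <= H)%O.
Proof.
apply/idP/andP => [/finerP KGH | [/finerP KG /finerP KH]].
  split; apply/finerP => A /KGH[_ /setD1P[_ /imset2P[B C BG CH ->]]].
    by rewrite subsetI => /andP[? _]; exists B.
  by rewrite subsetI => /andP[_ ?]; exists C.
apply/finerP => A AK; have [B BG AB] := KG A AK; have [C CH AC] := KH A AK.
exists (B :&: C); last by rewrite subsetI AB.
rewrite in_setD1 imset2_f // andbT.
have /and3P[_ _ n0K] := dpartition_partition K.
apply: contraNneq n0K => e0; suff /eqP <- : A == set0 by [].
by rewrite -subset0 -e0 subsetI AB.
Qed.

HB.instance Definition _ I n (d : 'I_n -> I) :=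
  Order.POrder_isMeetSemilattice.Build refinement_display (dpartition d)
    (@refines_dmeet I n d).

(* Removing [set0] only matters for n = 0. *)
Definition top_blocks n : {set {set 'I_n}} := [set [set: 'I_n]] :\ set0.

Lemma top_blocks_partition n : partition (top_blocks n) [set: 'I_n].
Proof.
apply/and3P; split; last by rewrite !inE eqxx.
  apply/eqP/setP => x; rewrite inE; apply/bigcupP.
  exists [set: 'I_n]; rewrite ?inE // eqxx andbT.
  by apply/set0Pn; exists x; rewrite inE.
apply/trivIsetP => B C /setD1P[_ /set1P ->] /setD1P[_ /set1P ->].
by rewrite eqxx.
Qed.

Definition dtop I n (d : 'I_n -> I) : dpartition d :=
  DPartition d (top_blocks_partition n).

Lemma refines_dtop I n (d : 'I_n -> I) (G : dpartition d) : (G <= dtop d)%O.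
Proof.
apply/finerP => B BG; exists [set: 'I_n]; last exact: subsetT.
have /and3P[_ _ n0G] := dpartition_partition G.
rewrite !inE eqxx andbT; apply: contraNneq n0G => T0.
by suff /eqP <- : B == set0 by []; rewrite -subset0 -T0 subsetT.
Qed.

HB.instance Definition _ I n (d : 'I_n -> I) :=
  Order.hasTop.Build refinement_display (dpartition d) (@refines_dtop I n d).

Definition djoin I n (d : 'I_n -> I) (G H : dpartition d) : dpartition d :=
  (\meet_(K : dpartition d | (G <= K) && (H <= K)) K)%O.

Lemma djoin_refines I n (d : 'I_n -> I) (G H K : dpartition d) :
  (djoin G H <= K)%O = (G <= K)%O && (H <= K)%O.
Proof.
apply/idP/idP => [le|ub]; last by rewrite /djoin meets_inf.
have ub : ((G <= djoin G H) && (H <= djoin G H))%O.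
  by apply/andP; split; apply/meetsP => L /andP[].
by case/andP: ub => GJ HJ; rewrite (le_trans GJ le) (le_trans HJ le).
Qed.

HB.instance Definition _ I n (d : 'I_n -> I) :=
  Order.POrder_isJoinSemilattice.Build refinement_display (dpartition d)
    (@djoin_refines I n d).

(** ** Allowed permutations *)

Definition perm_blocks n (s : 'S_n) (G : {set {set 'I_n}}) : {set {set 'I_n}} :=
  [set s @: B | B : {set 'I_n} in G].

Definition perm_dec I n (s : 'S_n) (d : 'I_n -> I) : 'I_n -> I :=
  fun j => d (s^-1%g j).

Definition allowed_move I (eps : I -> I -> bool) n (d : 'I_n -> I)
    (G : {set {set 'I_n}}) (i j : 'I_n) : Prop :=
  [/\ j = i.+1 :> nat,
      eps (d i) (d j) = true
    & d i <> d j \/ (d i = d j /\ pblock G i <> pblock G j)].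

(* The product of permutations is read from left to right:
   (s * t)%g x = t (s x), so that [s * tperm i j] applies [s] first. *)
Inductive allowed_perm I (eps : I -> I -> bool) n (d : 'I_n -> I)
    (G : {set {set 'I_n}}) : 'S_n -> Prop :=
| allowed_perm_id : allowed_perm eps d G 1%g
| allowed_perm_step (s : 'S_n) (i j : 'I_n) :
    allowed_perm eps d G s ->
    allowed_move eps (perm_dec s d) (perm_blocks s G) i j ->
    allowed_perm eps d G (s * tperm i j)%g.

(** ** Standardization and reductions *)

Definition is_interval n (B : {set 'I_n}) : Prop :=
  exists a b : nat, B = [set k : 'I_n | a <= k <= b].

(* [nth_elt X] is the increasing bijection from 'I_#|X| onto [X], since the
   enumeration of a subset of 'I_n is increasing. *)
Definition nth_elt n (X : {set 'I_n}) : 'I_#|X| -> 'I_n := @enum_val _ (mem X).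

Definition st_blocks n (X : {set 'I_n}) (G : {set {set 'I_n}}) :
    {set {set 'I_#|X|}} :=
  [set [set k | nth_elt k \in B] | B : {set 'I_n} in G].

Definition st_dec I n (X : {set 'I_n}) (d : 'I_n -> I) : 'I_#|X| -> I :=
  fun k => d (nth_elt k).

(* The index type changes along a reduction, hence the indices n, d, G. *)
Inductive eps_noncrossing I (eps : I -> I -> bool) :
    forall n, ('I_n -> I) -> {set {set 'I_n}} -> Prop :=
| eps_noncrossing_empty (d : 'I_0 -> I) : eps_noncrossing eps d set0
| eps_noncrossing_reduce n (d : 'I_n -> I) (G : {set {set 'I_n}})
    (s : 'S_n) (B : {set 'I_n}) :
    B \in G ->
    allowed_perm eps d G s ->
    is_interval (s @: B) ->
    eps_noncrossing eps (st_dec (X := ~: (s @: B)) (perm_dec s d))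
      (st_blocks (~: (s @: B)) (perm_blocks s G :\ s @: B)) ->
    eps_noncrossing eps d G.

Definition noncrossing_partition I (eps : I -> I -> bool) n (d : 'I_n -> I) :
    dpartition d -> Prop :=
  fun G => eps_noncrossing eps d G.

Arguments noncrossing_partition {I} eps {n} d G.

(** ** Meets and joins in a subset of a poset, for the induced order *)

Definition is_meet_in disp (T : porderType disp) (S : T -> Prop) (x y z : T) :
    Prop :=
  [/\ S z, (z <= x)%O, (z <= y)%O
    & forall w, S w -> (w <= x)%O -> (w <= y)%O -> (w <= z)%O].

Definition is_join_in disp (T : porderType disp) (S : T -> Prop) (x y z : T) :
    Prop :=
  [/\ S z, (x <= z)%O, (y <= z)%O
    & forall w, S w -> (x <= w)%O -> (y <= w)%O -> (z <= w)%O].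

Definition is_lattice_in disp (T : porderType disp) (S : T -> Prop) : Prop :=
  forall x y, S x -> S y ->
    (exists z, is_meet_in S x y z) /\ (exists z, is_join_in S x y z).

(* Main.v *)
Require Import Defs.
From Stdlib Require Import Classical_Prop.
From mathcomp Require Import all_boot all_order all_fingroup.

Set Implicit Arguments.
Unset Strict Implicit.
Unset Printing Implicit Defensive.

Import Order.Theory.

(** The point is to forget the side condition on allowed moves.  A swap of two
    neighbours of the same colour lying in the same block leaves the decorated
    partition unchanged, so admitting such swaps as soon as [eps] permits them
    changes neither the decorated partitions that can be reached nor, therefore,
    which partitions are noncrossing.  The swaps that are then available depend
    on the colours only, not on the partition: they are those of a partially
    commutative monoid (a trace monoid).

    Accordingly a decorated partition is read as a word, each letter carrying
    a colour and a label, and two letters lie in the same block when they have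
    the same label.  Such a word is noncrossing ([nc_word]) when it can be
    emptied by repeatedly swapping commuting neighbours and cutting out a factor
    consisting of all the letters with a given label.
    The equivalence with noncrossing partitions is given by
    [nc_word_of_eps_noncrossing] and [eps_noncrossing_of_nc_word].

    For words the following facts are easy: being noncrossing is invariant
    under commutation and inherited by subwords ([nc_word_trace],
    [nc_word_filter]), and a noncrossing word may be inserted as a factor into
    another one with which it shares no label ([nc_word_insert]).  Let now [w]
    be noncrossing for two labellings [f] and [g]
    ([nc_word_meet]).  Up to commutation [w = u b v] with [b] a full block of
    [f] and [u v] noncrossing for [f].  The subwords [b] and [u v] are
    noncrossing for [g], hence for the pair [(f, g)]: the first because [f] is
    constant on it, the second by induction.  Inserting [b] back shows that [w]
    is noncrossing for [(f, g)], which is the labelling of the meet.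

    Finally the one-block partition is noncrossing, so joins are meets of the
    finitely many noncrossing upper bounds ([meet_closed_is_lattice_in]). *)

(** * Partially commutative words *)

Lemma filter_none (T : eqType) (p : pred T) (s : seq T) :
  {in s, forall x, ~~ p x} -> filter p s = [::].
Proof.
move=> sp; rewrite -(filter_pred0 s); apply: eq_in_filter => x /sp.
exact: negbTE.
Qed.

Lemma filter_every (T : eqType) (p : pred T) (s : seq T) :
  {in s, forall x, p x} -> filter p s = s.
Proof. by move=> sp; apply/all_filterP/allP. Qed.

Section Words.

Variables (I : Type) (eps : I -> I -> bool).

(** [trace_eq c w w'] says that [w'] is obtained from [w] by swapping
    neighbouring letters whose colours, given by [c], commute according to
    [eps]. *)
Inductive trace_eq (A : Type) (c : A -> I) (w : seq A) : seq A -> Prop :=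
| trace_eq_refl : trace_eq c w w
| trace_eq_swap u x y v :
    trace_eq c w (u ++ x :: y :: v) -> eps (c x) (c y) ->
    trace_eq c w (u ++ y :: x :: v).

(** [nc_word c f w] says that [w], with colouring [c] and labelling [f], is
    noncrossing.  In the second rule [b] consists of all the letters
    with a given label, and is required to be nonempty as blocks are. *)
Inductive nc_word (A L : eqType) (c : A -> I) (f : A -> L) : seq A -> Prop :=
| nc_word_nil : nc_word c f [::]
| nc_word_cut w u b v :
    b != [::] -> trace_eq c w (u ++ b ++ v) ->
    {in b &, forall x y, f x = f y} ->
    {in b & u ++ v, forall x y, f x != f y} ->
    nc_word c f (u ++ v) -> nc_word c f w.

Lemma trace_eq_trans (A : Type) (c : A -> I) w1 w2 w3 :
  trace_eq c w1 w2 -> trace_eq c w2 w3 -> trace_eq c w1 w3.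
Proof.
move=> e12; elim=> // u x y v _ e1 exy.
exact: trace_eq_swap e1 exy.
Qed.

Lemma trace_eq_sym (A : Type) (c : A -> I) w1 w2 :
  (forall i j, eps i j = eps j i) -> trace_eq c w1 w2 -> trace_eq c w2 w1.
Proof.
move=> eps_sym; elim=> [|u x y v _ e1 exy]; first exact: trace_eq_refl.
apply: trace_eq_trans e1; apply: trace_eq_swap; first exact: trace_eq_refl.
by rewrite eps_sym.
Qed.

Lemma trace_eq_cat (A : Type) (c : A -> I) p q w1 w2 :
  trace_eq c w1 w2 -> trace_eq c (p ++ w1 ++ q) (p ++ w2 ++ q).
Proof.
elim=> [|u x y v _ e1 exy]; first exact: trace_eq_refl.
move: e1; rewrite -!catA !(catA p) !cat_cons => e1.
exact: trace_eq_swap e1 exy.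
Qed.

Lemma trace_eq_filter (A : Type) (c : A -> I) (p : pred A) w1 w2 :
  trace_eq c w1 w2 -> trace_eq c (filter p w1) (filter p w2).
Proof.
elim=> [|u x y v _]; first exact: trace_eq_refl.
rewrite !filter_cat /=; case: (p x); case: (p y) => //= e1 exy.
exact: trace_eq_swap e1 exy.
Qed.

Lemma trace_eq_map (A A' : Type) (c : A -> I) (c' : A' -> I) (h : A' -> A)
    w1 w2 :
  (forall x, c (h x) = c' x) -> trace_eq c' w1 w2 ->
  trace_eq c (map h w1) (map h w2).
Proof.
move=> hc; elim=> [|u x y v _]; first exact: trace_eq_refl.
rewrite !map_cat /= => e1 exy; apply: trace_eq_swap e1 _.
by rewrite !hc.
Qed.

Lemma trace_eq_perm (A : eqType) (c : A -> I) (w1 w2 : seq A) :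
  trace_eq c w1 w2 -> perm_eq w1 w2.
Proof.
elim=> // u x y v _ e1 _; apply: (perm_trans e1).
by rewrite perm_cat2l (perm_catCA [:: x] [:: y]).
Qed.

Lemma nc_word_trace (A L : eqType) (c : A -> I) (f : A -> L) w1 w2 :
  (forall i j, eps i j = eps j i) ->
  nc_word c f w1 -> trace_eq c w1 w2 -> nc_word c f w2.
Proof.
move=> eps_sym nc1 e12; case: nc1 e12 => [/trace_eq_perm|w u b v b0 e bb bo nc e12].
  by rewrite perm_sym => /perm_nilP ->; apply: nc_word_nil.
apply: nc_word_cut b0 _ bb bo nc.
by apply: trace_eq_trans e; apply: trace_eq_sym.
Qed.

(** Restriction of a noncrossing partition to a subset. *)
Lemma nc_word_filter (A L : eqType) (c : A -> I) (f : A -> L) (p : pred A) w :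
  (forall i j, eps i j = eps j i) ->
  nc_word c f w -> nc_word c f (filter p w).
Proof.
move=> eps_sym; elim=> [|{}w u b v b0 e bb bo _]; first exact: nc_word_nil.
rewrite filter_cat => nc.
have := trace_eq_filter p e; rewrite !filter_cat => {}e.
(* If no letter of [b] survives, there is nothing to cut out. *)
case: (eqVneq (filter p b) [::]) => pb.
  rewrite pb /= in e; apply: (nc_word_trace eps_sym nc).
  exact: trace_eq_sym.
apply: (nc_word_cut pb e) => // x y.
  by rewrite !mem_filter => /andP[_ xb] /andP[_ yb]; apply: bb.
rewrite -filter_cat !mem_filter => /andP[_ xb] /andP[_ yb].
exact: bo.
Qed.

(** Only the equality relation between labels matters. *)
Lemma nc_word_relabel (A L L' : eqType) (c : A -> I) (f : A -> L)
    (g : A -> L') w :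
  {in w &, forall x y, (f x == f y) = (g x == g y)} ->
  nc_word c f w -> nc_word c g w.
Proof.
move=> fg nc; elim: nc fg => [|{}w u b v b0 e bb bo _ IH] fg.
  exact: nc_word_nil.
have wE : w =i u ++ b ++ v by apply/perm_mem/(trace_eq_perm e).
have bw : {subset b <= w} by move=> x xb; rewrite wE !mem_cat xb orbT.
have ow : {subset u ++ v <= w}.
  by move=> x; rewrite wE !mem_cat => /orP[] ->; rewrite ?orbT.
apply: (nc_word_cut b0 e).
- by move=> x y xb yb; apply/eqP; rewrite -fg ?bw // (bb x y).
- by move=> x y xb yo; rewrite -fg ?(bw x) ?(ow y) //; apply: bo.
- by apply: IH => x y xo yo; apply: fg; apply: ow.
Qed.

Lemma nc_word_map (A A' L : eqType) (c : A -> I) (c' : A' -> I) (f : A -> L)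
    (h : A' -> A) w :
  (forall x, c (h x) = c' x) ->
  nc_word c' (f \o h) w -> nc_word c f (map h w).
Proof.
move=> hc; elim=> [|{}w u b v b0 e bb bo _ IH]; first exact: nc_word_nil.
have := trace_eq_map hc e; rewrite !map_cat => {}e.
apply: (nc_word_cut _ e).
- by case: (b) b0.
- by move=> _ _ /mapP[x xb ->] /mapP[y yb ->]; apply: bb.
- move=> _ y /mapP[x xb ->]; rewrite -map_cat => /mapP[{}y yo ->].
  exact: bo.
- by rewrite -map_cat.
Qed.

Lemma nc_word_insert (A L : eqType) (c : A -> I) (f : A -> L) u b v :
  nc_word c f (u ++ v) -> nc_word c f b ->
  {in b & u ++ v, forall x y, f x != f y} ->
  nc_word c f (u ++ b ++ v).
Proof.
move=> nco; elim=> // w u' b' v' b0 e bb bo _ IH wo.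
have wE : w =i u' ++ b' ++ v' by apply/perm_mem/(trace_eq_perm e).
have := trace_eq_cat u v e.
rewrite -!catA (catA u u') => {}e; apply: (nc_word_cut b0 e bb).
  move=> x y xb yo; have /orP[yo'|yo'] : (y \in u ++ v) || (y \in u' ++ v').
  - by move: yo; rewrite !mem_cat; do 4 case: (y \in _).
  - by apply: wo yo'; rewrite wE !mem_cat xb orbT.
  - exact: bo.
rewrite -catA (catA u'); apply: IH => x y xb; apply: wo.
by rewrite wE !mem_cat orbCA -mem_cat xb orbT.
Qed.

(** The pair of two labellings labels the meet of the two partitions. *)
Lemma nc_word_meet (A L L' : eqType) (c : A -> I) (f : A -> L) (g : A -> L') w :
  (forall i j, eps i j = eps j i) ->
  nc_word c f w -> nc_word c g w -> nc_word c (fun x => (f x, g x)) w.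
Proof.
move=> eps_sym; elim=> [|{}w u b v b0 e bb bo _ IH] ncg.
  exact: nc_word_nil.
have {}ncg := nc_word_trace eps_sym ncg e.
apply: (nc_word_trace eps_sym _ (trace_eq_sym eps_sym e)).
(* [b] and [u ++ v] are the subwords on which [f x \in map f b] is true,
   resp. false. *)
have bP : {in b, forall x, f x \in map f b} by move=> x; apply: map_f.
have oP : {in u ++ v, forall x, f x \notin map f b}.
  by move=> x xo; apply/mapP => -[y yb /eqP]; rewrite eq_sym (negPf (bo _ _ _ _)).
have uP : {in u, forall x, f x \notin map f b}.
  by move=> x xu; apply: oP; rewrite mem_cat xu.
have vP : {in v, forall x, f x \notin map f b}.
  by move=> x xv; apply: oP; rewrite mem_cat xv orbT.
have := nc_word_filter (fun x => f x \in map f b) eps_sym ncg.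
rewrite !filter_cat (filter_none uP) (filter_none vP) (filter_every bP) cats0.
move=> /= ncb.
have := nc_word_filter (fun x => f x \notin map f b) eps_sym ncg.
rewrite !filter_cat (filter_every uP) (filter_every vP) filter_none /=; last first.
  by move=> x /bP; rewrite negbK.
move=> nco.
apply: nc_word_insert; first exact: IH.
- apply: nc_word_relabel ncb => x y xb yb.
  by rewrite xpair_eqE (bb x y) // eqxx.
- by move=> x y xb yo; rewrite xpair_eqE (negPf (bo _ _ _ _)).
Qed.

End Words.

(** * Sorted enumerations of ordinals *)

Lemma mem_take_enum_ord n k (x : 'I_n) : (x \in take k (enum 'I_n)) = (x < k).
Proof.
rewrite -(mem_map val_inj) map_take val_enum_ord take_iota mem_iota add0n /=.
by rewrite leq_min ltn_ord andbT.
Qed.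

Lemma mem_drop_enum_ord n k (x : 'I_n) : (x \in drop k (enum 'I_n)) = (k <= x).
Proof.
rewrite -(mem_map val_inj) map_drop val_enum_ord drop_iota mem_iota !add0n.
case: (leqP k x) => //= kx; rewrite subnKC ?ltn_ord //.
exact: leq_trans kx (ltnW (ltn_ord x)).
Qed.

Lemma enum_setE (T : finType) (X : {set T}) :
  enum X = [seq x <- enum T | x \in X].
Proof. by rewrite [in LHS]/enum_mem -enumT. Qed.

Lemma enum_ord_interval n k l (X : {set 'I_n}) :
  k <= l -> X = [set x : 'I_n | k <= x < l] ->
  enum 'I_n = take k (enum 'I_n) ++ enum X ++ drop l (enum 'I_n) /\
  enum (~: X) = take k (enum 'I_n) ++ drop l (enum 'I_n).
Proof.
move=> kl XE; set e := enum 'I_n.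
have eE : e = take k e ++ drop k (take l e) ++ drop l e.
  by rewrite catA -{1}(take_takel e kl) !cat_take_drop.
have memM x : x \in drop k (take l e) -> x \in X.
  move=> xm; rewrite XE inE -mem_take_enum_ord (mem_drop xm) andbT.
  rewrite leqNgt -mem_take_enum_ord -/e; apply/negP => xt.
  have := enum_uniq 'I_n; rewrite -/e eE catA cat_uniq => /andP[/[swap] _].
  by rewrite cat_uniq => /and3P[_ /hasPn/(_ _ xm)/negP].
have memT x : x \in take k e -> x \notin X.
  by rewrite mem_take_enum_ord XE inE ltnNge => /negPf ->.
have memD x : x \in drop l e -> x \notin X.
  by rewrite mem_drop_enum_ord XE inE (ltnNge x) andbC => ->.
have XM : enum X = drop k (take l e).
  rewrite enum_setE -/e {1}eE !filter_cat (filter_none memT) (filter_none memD).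
  by rewrite cats0 filter_every.
split; first by rewrite XM.
rewrite enum_setE -/e {1}eE !filter_cat filter_every /=; last first.
  by move=> x; rewrite inE; apply: memT.
rewrite filter_none /=; last by move=> x /memM; rewrite inE negbK.
by rewrite filter_every // => x; rewrite inE; apply: memD.
Qed.

Lemma enum_ord_tperm n (i j : 'I_n) : j = i.+1 :> nat ->
  exists u v, [/\ enum 'I_n = u ++ i :: j :: v,
                  map (tperm i j) (enum 'I_n) = u ++ j :: i :: v
                & size u = i].
Proof.
move=> ij; set e := enum 'I_n.
have se : size e = n by rewrite size_enum_ord.
have eE : e = take i e ++ i :: j :: drop j.+1 e.
  rewrite -{1}(cat_take_drop i e); congr (_ ++ _).
  rewrite (drop_nth i) ?se // nth_ord_enum; congr (_ :: _).
  by rewrite -ij (drop_nth i) ?se // nth_ord_enum.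
exists (take i e), (drop j.+1 e); split=> //; last first.
  by rewrite size_takel // se ltnW.
rewrite {1}eE map_cat /= tpermL tpermR.
have fixe (s : seq 'I_n) :
    (forall x, x \in s -> x != i /\ x != j) -> map (tperm i j) s = s.
  move=> sP; rewrite -[RHS]map_id; apply/eq_in_map => x /sP[xi xj].
  by rewrite tpermD // eq_sym.
congr (_ ++ _ :: _ :: _); apply: fixe => x;
  rewrite ?mem_take_enum_ord ?mem_drop_enum_ord -!val_eqE /= ij => xi;
  split; apply/eqP => xE; move: xi; rewrite xE ?ltnn //;
  by rewrite ltnNge leqnSn.
Qed.

(** * Blocks under permutation, standardization and meet *)

Lemma nth_eltP n (X : {set 'I_n}) k : nth_elt (X := X) k \in X.
Proof. exact: enum_valP. Qed.

Lemma map_nth_elt n (X : {set 'I_n}) :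
  map (@nth_elt n X) (enum 'I_#|X|) = enum X.
Proof.
have sz : size (map (@nth_elt n X) (enum 'I_#|X|)) = size (enum X).
  by rewrite size_map size_enum_ord cardE.
have [X0|[x xX]] := set_0Vmem X.
  have s0 : size (enum X) = 0 by rewrite -cardE X0 cards0.
  by rewrite (size0nil s0); apply: size0nil; rewrite sz s0.
apply: (eq_from_nth (x0 := x) sz) => k; rewrite size_map size_enum_ord => kX.
rewrite (nth_map (Ordinal kX)) ?size_enum_ord //.
by rewrite (nth_ord_enum _ (Ordinal kX)) /nth_elt (enum_val_nth x).
Qed.

Lemma partition_pblock (T : finType) (P : {set {set T}}) x :
  partition P [set: T] -> pblock P x \in P /\ x \in pblock P x.
Proof.
move=> /cover_partition cP; have xc : x \in cover P by rewrite cP inE.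
by rewrite pblock_mem // mem_pblock.
Qed.

Lemma perm_blocks_partition n (s : 'S_n) (P : {set {set 'I_n}}) :
  partition P [set: 'I_n] -> partition (perm_blocks s P) [set: 'I_n].
Proof.
move=> pP; have -> : [set: 'I_n] = s @: [set: 'I_n].
  by apply/esym/eqP; rewrite -subTset; apply/subsetP => x _;
    apply/imsetP; exists (s^-1%g x); rewrite ?inE ?permKV.
by rewrite /perm_blocks imset_partition //; apply: perm_inj.
Qed.

Lemma pblock_perm_blocks n (s : 'S_n) (P : {set {set 'I_n}}) x :
  partition P [set: 'I_n] ->
  pblock (perm_blocks s P) x = s @: pblock P (s^-1%g x).
Proof.
move=> pP; have [PB xB] := partition_pblock (s^-1%g x) pP.
apply: def_pblock; first exact: partition_trivIset (perm_blocks_partition s pP).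
- exact: imset_f.
- by rewrite -{1}(permKV s x) imset_f.
Qed.

Lemma st_blocks_partition n (X : {set 'I_n}) (H : {set {set 'I_n}}) :
  partition H X -> partition (st_blocks X H) [set: 'I_#|X|].
Proof.
move=> pH; have inj := @enum_val_inj _ (mem X).
have imX (B : {set 'I_n}) :
    B \subset X -> @nth_elt n X @: [set k | nth_elt k \in B] = B.
  move=> /subsetP BX; apply/setP => x; apply/imsetP/idP => [[k]|xB].
    by rewrite inE => kB ->.
  have xX := BX x xB; exists (enum_rank_in xX x);
    by rewrite ?inE /nth_elt enum_rankK_in.
rewrite -(imset_partition _ _ inj).
have -> : [set enum_val k | k in [set: 'I_#|X|]] = X.
  rewrite -[RHS]imX //.
  suff -> : [set: 'I_#|X|] = [set k | nth_elt (X := X) k \in X] by [].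
  by apply/setP => k; rewrite !inE nth_eltP.
suff -> : [set [set enum_val x | x in A]
            | A : {set 'I_#|X|} in st_blocks X H] = H.
  by [].
have HX B : B \in H -> B \subset X by apply: partitionS.
apply/setP => B; apply/imsetP/idP => [[_ /imsetP[C CH ->] ->]|BH].
  by rewrite imX ?HX.
by exists [set k | nth_elt (X := X) k \in B]; rewrite ?imset_f ?imX ?HX.
Qed.

Lemma pblock_st_blocks n (X : {set 'I_n}) (H : {set {set 'I_n}}) k :
  partition H X ->
  pblock (st_blocks X H) k = [set l | nth_elt l \in pblock H (nth_elt k)].
Proof.
move=> pH; have xc : nth_elt k \in cover H.
  by rewrite (cover_partition pH) nth_eltP.
apply: def_pblock; first exact: partition_trivIset (st_blocks_partition pH).
- by apply/imsetP; exists (pblock H (nth_elt k)); rewrite ?pblock_mem.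
- by rewrite inE mem_pblock.
Qed.

Lemma setC_partition n (P : {set {set 'I_n}}) B :
  partition P [set: 'I_n] -> B \in P -> partition (P :\ B) (~: B).
Proof. by move=> pP BP; rewrite -setTD; apply: partitionD1. Qed.

Lemma eq_pblock_st_blocks n (P : {set {set 'I_n}}) B (k l : 'I_#|~: B|) :
  partition P [set: 'I_n] -> B \in P ->
  (pblock (st_blocks (~: B) (P :\ B)) k == pblock (st_blocks (~: B) (P :\ B)) l)
  = (pblock P (nth_elt k) == pblock P (nth_elt l)).
Proof.
move=> pP BP; have pD := setC_partition pP BP.
have pS := st_blocks_partition pD.
rewrite eq_pblock ?(partition_trivIset pS) ?(cover_partition pS) ?inE //.
rewrite eq_pblock ?(partition_trivIset pP) ?(cover_partition pP) ?inE //.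
rewrite pblock_st_blocks // inE.
suff -> : pblock (P :\ B) (nth_elt k) = pblock P (nth_elt k) by [].
have [PC xC] := partition_pblock (nth_elt k) pP.
apply: def_pblock => //; first by apply: partition_trivIset pD.
rewrite !inE PC andbT; apply: contraTneq xC => ->.
by have := nth_eltP k; rewrite inE.
Qed.

Lemma pblock_meet_blocks n (G H : {set {set 'I_n}}) x :
  partition G [set: 'I_n] -> partition H [set: 'I_n] ->
  pblock (meet_blocks G H) x = pblock G x :&: pblock H x.
Proof.
move=> pG pH; have [BG xB] := partition_pblock x pG.
have [CH xC] := partition_pblock x pH.
apply: def_pblock; last by rewrite inE xB.
  exact: partition_trivIset (meet_blocks_partition pG pH).
rewrite in_setD1 imset2_f // andbT; apply/set0Pn; exists x.
by rewrite inE xB.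
Qed.

Lemma eq_pblock_meet_blocks n (G H : {set {set 'I_n}}) x y :
  partition G [set: 'I_n] -> partition H [set: 'I_n] ->
  (pblock (meet_blocks G H) x == pblock (meet_blocks G H) y) =
  (pblock G x == pblock G y) && (pblock H x == pblock H y).
Proof.
move=> pG pH; have pM := meet_blocks_partition pG pH.
rewrite !eq_pblock ?(partition_trivIset pM, cover_partition pM,
  partition_trivIset pG, cover_partition pG,
  partition_trivIset pH, cover_partition pH) ?inE //.
by rewrite pblock_meet_blocks // inE.
Qed.

(** * Noncrossing partitions as words *)

Section Translation.

Variables (I : Type) (eps : I -> I -> bool).

(** The letters of the word attached to a decorated partition are the elements
    [x] of [n], with colour [d x] and label [pblock G x].  After the permutation
    [s], position [k] is occupied by the letter [s^-1 k]. *)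
Lemma allowed_perm_trace n (d : 'I_n -> I) (G : {set {set 'I_n}}) s :
  allowed_perm eps d G s ->
  trace_eq eps d (enum 'I_n) (map (s^-1)%g (enum 'I_n)).
Proof.
elim=> [|{}s i j _ IH [ij eij _]].
  rewrite (eq_map (g := id)) ?map_id; first exact: trace_eq_refl.
  by move=> x; rewrite invg1 perm1.
have [u [v [eE tE _]]] := enum_ord_tperm ij.
have -> : map (s * tperm i j)^-1%g (enum 'I_n) =
          map (s^-1)%g (map (tperm i j) (enum 'I_n)).
  by rewrite -[RHS]map_comp; apply: eq_map => x; rewrite invMg tpermV permM.
rewrite {2}eE map_cat /= in IH.
by rewrite tE map_cat /=; apply: trace_eq_swap IH _.
Qed.

Lemma nc_word_of_eps_noncrossing n (d : 'I_n -> I) (G : {set {set 'I_n}}) :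
  eps_noncrossing eps d G -> partition G [set: 'I_n] ->
  nc_word eps d (pblock G) (enum 'I_n).
Proof.
elim=> {n d G} [d _|n d G s B BG als [a [b BE]] _ IH pG].
  have -> : enum 'I_0 = [::] by apply: size0nil; rewrite size_enum_ord.
  exact: nc_word_nil.
have psG := perm_blocks_partition s pG.
have sBG : s @: B \in perm_blocks s G by apply: imset_f.
have sVB x : (x \in s @: B) = (s^-1%g x \in B).
  by rewrite -{1}(permKV s x) mem_imset //; apply: perm_inj.
have {}IH := IH (st_blocks_partition (setC_partition psG sBG)).
have B0 : s @: B != set0 := partition_neq0 psG sBG.
have [x] := set0Pn _ B0; rewrite BE inE => /andP[ax xb].
have ab : a <= b.+1 by apply: leq_trans ax (leqW xb).
have [e eC] := enum_ord_interval ab BE.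
have := allowed_perm_trace als.
rewrite [X in trace_eq _ _ _ (map _ X)]e !map_cat => tr.
apply: (nc_word_cut _ tr).
- by rewrite -size_eq0 size_map -cardE cards_eq0.
- have bP z : z \in map (s^-1)%g (enum (s @: B)) -> pblock G z = B.
    move=> /mapP[y]; rewrite mem_enum sVB => yB ->.
    exact: def_pblock (partition_trivIset pG) BG yB.
  by move=> y z /bP -> /bP ->.
- move=> _ z0 /mapP[y + ->]; rewrite mem_enum sVB => yB.
  rewrite -map_cat -eC => /mapP[z + ->]; rewrite mem_enum inE sVB => zB.
  rewrite (def_pblock (partition_trivIset pG) BG yB).
  rewrite eq_sym; apply: contraNneq zB => <-.
  by have [] := partition_pblock (s^-1%g z) pG.
(* The word of the standardization is the remaining subword, the [k]-th
   position being occupied by the letter [s^-1 (nth_elt k)]. *)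
rewrite -map_cat -eC -map_nth_elt -map_comp.
apply: (nc_word_map (c' := st_dec (perm_dec s d))) => //.
apply: nc_word_relabel IH => k l _ _ /=.
rewrite eq_pblock_st_blocks // !pblock_perm_blocks //.
by rewrite (inj_eq (imset_inj (@perm_inj _ s))).
Qed.

(** The letters [t 0, t 1, ...] carry the colours of the decoration [d], and
    their labels describe the partition [G]. *)
Definition spells (A L : eqType) (c : A -> I) (f : A -> L) n (d : 'I_n -> I)
    (G : {set {set 'I_n}}) (t : 'I_n -> A) : Prop :=
  (forall i, d i = c (t i)) /\
  (forall i j, (pblock G i == pblock G j) = (f (t i) == f (t j))).

(** Commutations of a word are realized by allowed permutations of the
    partition.  Swaps of letters with equal colour and label need no move, as
    they do not change the decorated partition; the resulting [t'] is thus in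
    general not [t \o s^-1]. *)
Lemma spells_trace (A L : eqType) (c : A -> I) (f : A -> L) n (d : 'I_n -> I)
    (G : {set {set 'I_n}}) (t : 'I_n -> A) w :
  partition G [set: 'I_n] -> spells c f d G t ->
  trace_eq eps c (map t (enum 'I_n)) w ->
  exists s t', [/\ allowed_perm eps d G s, map t' (enum 'I_n) = w
    & spells c f (perm_dec s d) (perm_blocks s G) t'].
Proof.
move=> pG [dt Gt]; elim=> [|u x y v _ [s [t' [als tE [dt' Gt']]]] exy].
  exists 1%g, t; split=> //; first exact: allowed_perm_id.
  split=> [i|i j]; first by rewrite /perm_dec invg1 perm1.
  rewrite !pblock_perm_blocks // (inj_eq (imset_inj (@perm_inj _ _))).
  by rewrite invg1 !perm1.
have sE : n = size u + (size v).+2.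
  by rewrite -(size_enum_ord n) -(size_map t') tE size_cat.
have iP : size u < n by rewrite sE -addSnnS leq_addr.
have jP : (size u).+1 < n by rewrite sE -!addSnnS leq_addr.
pose i := Ordinal iP; pose j := Ordinal jP.
have [e1 [e2 [eE eT se]]] := enum_ord_tperm (erefl : j = i.+1 :> nat).
have := tE; rewrite {1}eE map_cat => /eqP.
rewrite eqseq_cat ?size_map // => /andP[/eqP t1 /eqP[ti tj t2]].
have tE' : map (t' \o tperm i j) (enum 'I_n) = u ++ y :: x :: v.
  by rewrite map_comp eT map_cat /= t1 ti tj t2.
have psG := perm_blocks_partition s pG.
have [[fxy cxy]|nfc] := classic (f x = f y /\ c x = c y).
  exists s, (t' \o tperm i j); split=> //.
  have ft k : f (t' (tperm i j k)) = f (t' k).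
    by case: tpermP => [->|->|//]; rewrite ?ti ?tj.
  split=> [k|k l] /=; last by rewrite !ft.
  by rewrite dt'; case: tpermP => [->|->|//]; rewrite ?ti ?tj.
exists (s * tperm i j)%g, (t' \o tperm i j); split=> //.
  apply: allowed_perm_step als _; split=> //.
    by rewrite !dt' ti tj.
  rewrite !dt' ti tj; have [cxy|] := classic (c x = c y); last by left.
  right; split=> //; apply/eqP; rewrite Gt' ti tj; apply/eqP => fxy.
  exact: nfc.
have tV k : ((s * tperm i j)^-1 k = s^-1 (tperm i j k))%g.
  by rewrite invMg tpermV permM.
split=> [k|k l]; first by rewrite /perm_dec tV -dt'.
rewrite -Gt' !pblock_perm_blocks // !tV.
by rewrite !(inj_eq (imset_inj (@perm_inj _ _))).
Qed.

Lemma eps_noncrossing_of_nc_word (A L : eqType) (c : A -> I) (f : A -> L) w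
    n (d : 'I_n -> I) (G : {set {set 'I_n}}) (t : 'I_n -> A) :
  nc_word eps c f w -> partition G [set: 'I_n] -> spells c f d G t ->
  map t (enum 'I_n) = w -> eps_noncrossing eps d G.
Proof.
move=> nc; elim: nc n d G t => {w} [|w u b v b0 tr bb bo _ IH] n d G t pG sp tE.
  have n0 : n = 0 by rewrite -(size_enum_ord n) -(size_map t) tE.
  subst n; have -> : G = set0.
    apply/eqP; rewrite -partition_set0; move: pG.
    by congr partition; apply/setP => -[].
  exact: eps_noncrossing_empty.
rewrite -tE in tr; have [s [t' [als tE' [dt Gt]]]] := spells_trace pG sp tr.
have psG := perm_blocks_partition s pG.
(* The positions of the factor [b] form a block that is an interval. *)
pose X := [set x : 'I_n | size u <= x < size u + size b].
have [eE eC] := enum_ord_interval (leq_addr (size b) (size u)) (erefl X).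
have sE : n = size u + (size b + size v).
  by rewrite -(size_enum_ord n) -(size_map t') tE' !size_cat.
have tu : map t' (take (size u) (enum 'I_n)) = u.
  by rewrite map_take tE' take_size_cat.
have tv : map t' (drop (size u + size b) (enum 'I_n)) = v.
  by rewrite map_drop tE' catA drop_size_cat ?size_cat.
have tb : map t' (enum X) = b.
  move: (tE'); rewrite {1}eE !map_cat tu tv => e.
  have sz : size (map t' (enum X)) = size b.
    by move/(congr1 size): e; rewrite !size_cat => /addnI/addIn.
  by move/eqP: e; rewrite eqseq_cat // eqxx eqseq_cat // eqxx andbT => /eqP.
have inX x : x \in X -> t' x \in b by move=> xX; rewrite -tb map_f ?mem_enum.
have outX x : x \notin X -> t' x \in u ++ v.
  by move=> xX; rewrite -tu -tv -map_cat -eC map_f // mem_enum inE.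
have b_gt0 : 0 < size b by rewrite lt0n size_eq0.
have i0P : size u < n by rewrite sE -addn1 leq_add2l addn_gt0 b_gt0.
pose i0 := Ordinal i0P.
have i0X : i0 \in X by rewrite inE /= leqnn -addn1 leq_add2l.
have XE : X = pblock (perm_blocks s G) i0.
  apply/setP => x.
  rewrite -eq_pblock ?(partition_trivIset psG) ?(cover_partition psG) ?in_setT //.
  rewrite Gt; have [xX|xX] := boolP (x \in X).
    by rewrite (bb _ (t' x)) ?eqxx ?inX.
  by apply/esym; apply: negbTE; apply: bo; [apply: inX | apply: outX].
have : X \in perm_blocks s G by rewrite XE; have [] := partition_pblock i0 psG.
move=> XG; have /imsetP[B BG sBX] := XG.
apply: (eps_noncrossing_reduce BG als); rewrite -sBX.
  exists (size u), (size u + size b).-1; apply/setP => x; rewrite !inE.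
  by rewrite -[in LHS](prednK b_gt0) -[in RHS](prednK b_gt0) addnS ltnS.
apply: (IH _ _ _ (t' \o @nth_elt n (~: X))).
- exact: st_blocks_partition (setC_partition psG XG).
- split=> [k|k l]; first exact: dt.
  by rewrite eq_pblock_st_blocks // Gt.
- by rewrite map_comp map_nth_elt eC map_cat tu tv.
Qed.

End Translation.

(** * Lattices from meets *)

(** [s] lists the elements of the finite type [T].  As [S] need not be
    decidable, the join of [x] and [y] is found by running through [s],
    deciding classically whether each element is an upper bound in [S]. *)
Lemma meet_closed_is_lattice_in disp (T : tMeetSemilatticeType disp)
    (s : seq T) (S : T -> Prop) :
  (forall x, x \in s) -> S \top%O ->
  (forall x y, S x -> S y -> S (Order.meet x y)) ->
  is_lattice_in S.
Proof.
move=> s_all St Sm x y Sx Sy; split.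
  exists (Order.meet x y); split; rewrite ?leIl ?leIr //.
    exact: Sm.
  by move=> w _ wx wy; rewrite lexI wx.
suff [z [Sz xz yz zP]] : exists z, [/\ S z, (x <= z)%O, (y <= z)%O &
    forall w, w \in s -> S w -> (x <= w)%O -> (y <= w)%O -> (z <= w)%O].
  by exists z; split=> // w; apply: zP.
elim: s {s_all} => [|u s [z [Sz xz yz zP]]].
  by exists \top%O; split; rewrite ?lex1.
have [[Su xu yu]|nu] := classic [/\ S u, (x <= u)%O & (y <= u)%O].
  exists (Order.meet u z); split; rewrite ?lexI ?xu ?yu //; first exact: Sm.
  move=> w; rewrite inE => /predU1P[-> *|ws Sw xw yw]; first exact: leIl.
  exact: le_trans (leIr _ _) (zP w ws Sw xw yw).
exists z; split=> // w; rewrite inE => /predU1P[-> *|]; last exact: zP.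
by case: nu.
Qed.

Theorem proposition4 (I : Type) (eps : I -> I -> bool)
    (eps_sym : forall i j : I, eps i j = eps j i)
    (n : nat) (d : 'I_n -> I) :
  (forall G H : dpartition d,
     noncrossing_partition eps d G -> noncrossing_partition eps d H ->
     is_meet_in (noncrossing_partition eps d) G H (Order.meet G H)) /\
  is_lattice_in (noncrossing_partition eps d).
Proof.
have meet_nc (G H : dpartition d) : noncrossing_partition eps d G ->
    noncrossing_partition eps d H ->
    noncrossing_partition eps d (Order.meet G H).
  have pG := dpartition_partition G; have pH := dpartition_partition H.
  move=> /nc_word_of_eps_noncrossing/(_ pG) ncG.
  move=> /nc_word_of_eps_noncrossing/(_ pH) ncH.
  have := nc_word_meet eps_sym ncG ncH.
  move=> /(@eps_noncrossing_of_nc_word I eps _ _ _ _ _ n d (meet_blocks G H) id).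
  apply; rewrite ?map_id //; first exact: meet_blocks_partition.
  by split=> // i j; rewrite eq_pblock_meet_blocks // xpair_eqE.
have top_nc : noncrossing_partition eps d (dtop d).
  apply: (@eps_noncrossing_of_nc_word I eps _ unit d (fun=> tt) (enum 'I_n)
    n d _ id); rewrite ?map_id //.
  - case: (eqVneq (enum 'I_n) [::]) => [->|n0]; first exact: nc_word_nil.
    apply: (@nc_word_cut _ _ _ _ _ _ _ [::] _ [::] n0) => //.
      by rewrite cats0; apply: trace_eq_refl.
    exact: nc_word_nil.
  - exact: dpartition_partition.
  - split=> // i j; have pT := dpartition_partition (dtop d).
    have blk k : pblock (dtop d) k = [set: 'I_n].
      have [] := partition_pblock k pT; rewrite /= in_setD1 => /andP[_].
      by rewrite inE => /eqP.
    by rewrite !blk !eqxx.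
split=> [G H ncG ncH|].
  split; rewrite ?leIl ?leIr //; first exact: meet_nc.
  by move=> K _ KG KH; rewrite lexI KG.
apply: (meet_closed_is_lattice_in (s := enum {: dpartition d}) _ top_nc meet_nc).
by move=> G; rewrite mem_enum.
Qed.
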